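(* Let $n\ge2$ and let $x_1,x_2,\dots$ be positive reals. For each integer $k$ with $0<k<n$, let $\Theta_k$ be the continuous-time Markov chain on words of length $n$ over the alphabet $\{1,2,\dots\}$ whose outgoing transitions from a word $u$ are $u\to\sigma_Su$ for all subsets $S\subseteq[n]$ with $|S|=k$, the transition corresponding to $S$ having rate $\prod_{i\in S}x_{u_i}$ (rates of transitions with the same endpoints add). Then, on the set of words with any fixed multiset of letters, the chains $\Theta_k$, $0<k<n$, all have the same stationary distribution.
   Context: Words $u=u_1\cdots u_n$ are considered cyclically: indices are taken modulo $n$, so $u_0=u_n$. For $i\in[n]$, $\sigma_i(u)$ is the word obtained by sorting the letters in positions $i-1$ and $i$: if $u_{i-1}\le u_i$ nothing changes, otherwise these two letters are swapped. $\sigma_j$ and $\sigma_k$ commute whenever $j\not\equiv k\pm1\pmod n$. For a proper subset $S\subsetneq[n]$, $\sigma_S$ is the composition of all $\sigma_j$, $j\in S$, where whenever $j-1,j\in S$ (cyclically), $\sigma_{j-1}$ is applied before $\sigma_j$; equivalently, split $S$ into maximal cyclic runs $j,j+1,\dots,j+m$ (mod $n$) and apply $\sigma_j,\sigma_{j+1},\dots,\sigma_{j+m}$ in this order within each run. For example, for $n=7$, $\sigma_{\{1,2,4,5,7\}}=\sigma_2\sigma_1\sigma_7\sigma_5\sigma_4$ (rightmost applied first). For $k=1$ this is the inhomogeneous multi-type TASEP on a ring. *)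

(* Defs.v *)
From HB Require Import structures.
From mathcomp Require Import all_boot all_order all_algebra.
From mathcomp Require Import reals.
Set Implicit Arguments. Unset Strict Implicit. Unset Printing Implicit Defensive.
Import Order.TTheory GRing.Theory Num.Theory.
Local Open Scope ring_scope.

(* Words of length n are sequences of nat of size n; positions and the
   indices of the operators sigma are 0-based: the paper's position / index
   i in [n] = {1..n} corresponds to i-1 here.  Indices are taken mod n. *)

Definition sigma (n j : nat) (u : seq nat) : seq nat :=
  let p := ((j + n - 1) %% n)%N in
  if (nth 0%N u p <= nth 0%N u j)%N then u
  else set_nth 0%N (set_nth 0%N u p (nth 0%N u j)) j (nth 0%N u p).

Definition inS (n : nat) (S : {set 'I_n}) (t : nat) : bool :=
  [exists i in S, val i == t].

(* sigma_S for a proper subset S: with m the least index not in S, apply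
   sigma_j for j = m+1, m+2, ..., m+n-1 (mod n) that lie in S, in this
   order (first one applied first).  Within each maximal cyclic run of S
   this is the increasing order required by the paper. *)
Definition sigmaS (n : nat) (S : {set 'I_n}) (u : seq nat) : seq nat :=
  let m := find (fun t => ~~ inS S t) (iota 0 n) in
  let order := [seq ((m + t) %% n)%N | t <- iota 1 n.-1 & inS S ((m + t) %% n)%N] in
  foldl (fun v j => sigma n j v) u order.

Definition trate {R : realType} (n : nat) (x : nat -> R) (S : {set 'I_n})
  (u : seq nat) : R :=
  \prod_(i in S) x (nth 0%N u i).

Definition rateK {R : realType} (n : nat) (x : nat -> R) (k : nat)
  (u v : seq nat) : R :=
  \sum_(S : {set 'I_n} | (#|S| == k) && (sigmaS S u == v)) trate x S u.

(* state space: all rearrangements of w (duplicate-free list) *)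
Definition states (w : seq nat) : seq (seq nat) := permutations w.

Definition genQ {R : realType} (n : nat) (x : nat -> R) (k : nat)
  (w : seq nat) (u v : seq nat) : R :=
  if u == v then - \sum_(v' <- states w | v' != u) rateK n x k u v'
  else rateK n x k u v.

Definition is_distr {R : realType} (w : seq nat) (pi : seq nat -> R) : Prop :=
  (forall u, u \in states w -> 0 <= pi u) /\ \sum_(u <- states w) pi u = 1.

Definition stationary {R : realType} (n : nat) (x : nat -> R) (k : nat)
  (w : seq nat) (pi : seq nat -> R) : Prop :=
  forall v, v \in states w -> \sum_(u <- states w) pi u * genQ n x k w u v = 0.

(* Main.v *)
(*
Write a_j for the operator (a_j f)(u) = x_{u_j} f(sigma_j u) on functions of
words.  While sigma_S is carried out, the letter at position j is still u_j when
sigma_j is applied, so the transfer operator M_k of Theta_k is the sum over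
|S| = k of the products a_S of the a_j, j in S, in cyclic order.  Its row sums
are elementary symmetric functions of the x_{u_i}, hence constant on the words
with given letters, and p is stationary for Theta_k iff it is a left eigenvector
of M_k for this row sum.

All M_k commute with M_1 = a_1 + ... + a_n.  Apart from a_i a_j = a_j a_i for
non-adjacent i, j, this rests on one local relation: for consecutive positions,
a_1 + a_2 commutes with the product "first a_1, then a_2".  It gives, by
induction along the runs of S, that a_S commutes with the sum of the a_i, i in S.
For i outside S, adding i at the end or at the start of a run of S produces the
same products, because every set has as many right ends as left ends of runs;
and if i+1 is in S, then "a_S, then a_i" is "a_{i+1}, then a_{S - (i+1) + i}".

Each Theta_k has a unique stationary distribution: choosing S inside {2..n}, no
letters are exchanged across the boundary between positions n and 1, so the
sorted word is reachable from every word.  Since M_k commutes with M_1, it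
preserves the stationary distribution of Theta_1, which is therefore stationary
for all Theta_k.
*)
Require Import Defs.
From HB Require Import structures.
From mathcomp Require Import all_boot all_order all_algebra.
From mathcomp Require Import reals.
From mathcomp Require Import perm.
From mathcomp Require Import zify ring lra.
Import Order.TTheory GRing.Theory Num.Theory.
Local Open Scope ring_scope.
Set Implicit Arguments. Unset Strict Implicit. Unset Printing Implicit Defensive.

(** * Sorting two cyclically adjacent letters *)

Section Sorting.
Local Open Scope nat_scope.

Definition prv (n j : nat) : nat := (j + n - 1) %% n.

Lemma prv_lt n j : j < n -> prv n j < n.
Proof. by move=> jn; rewrite /prv ltn_mod; lia. Qed.

Lemma prvE n j : j < n -> prv n j = if j == 0 then n.-1 else j.-1.
Proof.
move=> jn; rewrite /prv; case: j jn => [|j] jn /=.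
  by rewrite modn_small; lia.
have -> : j.+1 + n - 1 = j + n by lia.
by rewrite modnDr modn_small; lia.
Qed.

Lemma prv_modS n t : 0 < n -> prv n (t.+1 %% n) = t %% n.
Proof.
move=> n0; rewrite /prv -addnBA // modnDml.
have -> : t.+1 + (n - 1) = t + n by lia.
by rewrite modnDr.
Qed.

Lemma size_sigma n j u : size u = n -> j < n -> size (sigma n j u) = n.
Proof.
move=> su jn; rewrite /sigma; case: ifP => // _.
have := prv_lt jn; rewrite !size_set_nth su /prv; lia.
Qed.

Lemma nth_sigma n j u i : nth 0 (sigma n j u) i =
  if i == j then maxn (nth 0 u (prv n j)) (nth 0 u j)
  else if i == prv n j then minn (nth 0 u (prv n j)) (nth 0 u j)
  else nth 0 u i.
Proof.
rewrite /sigma -/(prv n j); case: leqP => h.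
  case: eqP => [->//|_]; by case: eqP => [->|_]; reflexivity.
by rewrite !nth_set_nth /= nth_set_nth /=.
Qed.

Lemma prv_inj n j k : j < n -> k < n -> prv n j = prv n k -> j = k.
Proof. by move=> jn kn; rewrite !prvE //; do 2!case: eqP; lia. Qed.

Lemma perm_sigma n j u : size u = n -> j < n -> perm_eq (sigma n j u) u.
Proof.
move=> su jn; have pn := prv_lt jn.
pose t := in_tuple u; pose J := cast_ord (esym su) (Ordinal jn).
pose P := cast_ord (esym su) (Ordinal pn).
rewrite /sigma -/(prv n j); case: leqP => // h.
apply/(@tuple_permP _ _ _ (in_tuple u)); exists (tperm P J).
apply: (@eq_from_nth _ 0); first by rewrite !size_set_nth size_tuple; lia.
move=> i; rewrite !size_set_nth => ilt.
have il : i < size u by lia.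
rewrite !nth_set_nth /= nth_set_nth /=.
transitivity (tnth [tuple tnth (in_tuple u) (tperm P J k) | k < size u] (Ordinal il));
  last by rewrite (tnth_nth 0).
rewrite tnth_mktuple (tnth_nth 0) /=.
case: tpermP => [/(congr1 val)|/(congr1 val)|] /=.
- move=> ->; rewrite eqxx; case: eqP => [->|_]; reflexivity.
- by move=> ->; rewrite eqxx.
move=> /eqP nP /eqP nJ; rewrite -!val_eqE /= in nP nJ.
by rewrite (negbTE nP) (negbTE nJ).
Qed.

(** Makes the pairs of positions sorted by [sigma n j] and [sigma n k] disjoint; the remaining
    inequality, between [prv n j] and [prv n k], comes from [prv_inj]. *)
Definition far (n j k : nat) := [&& j != k, prv n j != k & j != prv n k].

Lemma far_sym n j k : far n j k = far n k j.
Proof.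
by rewrite /far [k == j]eq_sym [prv n k == j]eq_sym [k == prv n j]eq_sym
  [(prv n j != k) && _]andbC.
Qed.

Lemma sigma_comm n j k u : size u = n -> j < n -> k < n -> far n j k ->
  sigma n j (sigma n k u) = sigma n k (sigma n j u).
Proof.
move=> su jn kn /and3P[/eqP jk /eqP pjk /eqP jpk].
have pp : prv n j <> prv n k by move/prv_inj; auto.
apply: (@eq_from_nth _ 0); first by rewrite !size_sigma // size_sigma.
move=> i _; rewrite !nth_sigma.
by repeat case: eqP => ? //; congruence.
Qed.

End Sorting.

(** * Weighted sorting operators and their local relations *)

Section Operators.
Variables (R : comNzRingType) (n : nat) (x : nat -> R).

Definition sigma_op (j : nat) (f : seq nat -> R) (u : seq nat) : R :=
  x (nth 0%N u j) * f (sigma n j u).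

Notation act := sigma_op.

(* The word is moved by the indices of l from left to right. *)
Definition sigma_ops (l : seq nat) (f : seq nat -> R) : seq nat -> R := foldr act f l.
Notation ops := sigma_ops.

Lemma ops_cat l l' f : ops (l ++ l') f = ops l (ops l' f).
Proof. by rewrite /ops foldr_cat. Qed.

(** Operator identities are stated pointwise on words of length [n]; this carries them under
    [ops]. *)
Lemma eq_ops l f g : {in l, forall j, (j < n)%N} ->
  (forall u, size u = n -> f u = g u) ->
  forall u, size u = n -> ops l f u = ops l g u.
Proof.
elim: l => [|j l IH] lj fg u su /=; first exact: fg.
have jn : (j < n)%N by apply: lj; rewrite inE eqxx.
rewrite /act IH ?size_sigma // => i il; by apply: lj; rewrite inE il orbT.
Qed.

Lemma ops_sum (I : Type) (r : seq I) (P : pred I) (F : I -> seq nat -> R) l u :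
  ops l (fun v => \sum_(i <- r | P i) F i v) u = \sum_(i <- r | P i) ops l (F i) u.
Proof.
elim: l u => //= j l IH u.
by rewrite /act IH big_distrr.
Qed.

Lemma act_comm j k f u : size u = n -> (j < n)%N -> (k < n)%N -> far n j k ->
  act j (act k f) u = act k (act j f) u.
Proof.
move=> su jn kn jk; rewrite /act (@sigma_comm _ k j) -1?far_sym // !nth_sigma.
case/and3P: jk => jk pjk jpk.
by rewrite [k == j]eq_sym (negbTE jk) (negbTE jpk) [k == _]eq_sym (negbTE pjk); ring.
Qed.

Lemma ops_comm l j f u : size u = n -> (j < n)%N -> {in l, forall i, (i < n)%N} ->
  {in l, forall i, far n i j} -> ops (rcons l j) f u = ops (j :: l) f u.
Proof.
move=> su jn; elim: l u su => [//|i l IH] u su lj lf.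
have il : (i < n)%N by apply: lj; rewrite inE eqxx.
rewrite rcons_cons -[LHS]/(x (nth 0%N u i) * ops (rcons l j) f (sigma n i u)) IH ?size_sigma //.
- rewrite -[LHS]/(act i (act j (ops l f)) u) act_comm //.
  by apply: lf; rewrite inE eqxx.
- by move=> k kl; apply: lj; rewrite inE kl orbT.
- by move=> k kl; apply: lf; rewrite inE kl orbT.
Qed.

Lemma ops_cat_comm l1 l2 f u : size u = n ->
  {in l1, forall i, (i < n)%N} -> {in l2, forall i, (i < n)%N} ->
  {in l1 & l2, forall i j, far n i j} -> ops (l1 ++ l2) f u = ops (l2 ++ l1) f u.
Proof.
move=> su h1; elim: l2 u su => [|j l2 IH] u su h2 h12; first by rewrite cats0.
have jn : (j < n)%N by apply: h2; rewrite inE eqxx.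
have h2' : {in l2, forall i, (i < n)%N}.
  by move=> i il; apply: h2; rewrite inE il orbT.
rewrite -cat_rcons ops_cat ops_comm //; last first.
  by move=> i il; apply: h12 => //; rewrite inE eqxx.
rewrite -ops_cat /= /act IH ?size_sigma //.
by move=> i k il kl; apply: h12 => //; rewrite inE kl orbT.
Qed.

(* For letters a, b, c at positions i, j, k: the first and last terms both lead to
   the sorted triple; the two middle terms lead to the same word, which is already
   sorted when c >= max(a, b). *)
Lemma act_braid i j k f u : size u = n -> (j < n)%N -> (k < n)%N ->
  i = prv n j -> j = prv n k -> i != j -> j != k -> i != k ->
  ops [:: j; k; j] f u + ops [:: j; k; k] f u =
  ops [:: j; j; k] f u + ops [:: k; j; k] f u.
Proof.
move=> su jn kn ij jk /eqP nij /eqP njk /eqP nik.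
have [nji nkj nki] : [/\ j <> i, k <> j & k <> i] by split; congruence.
have ilt : (i < n)%N by rewrite ij prv_lt.
rewrite /ops /= /act.
have [sj sk] : size (sigma n j u) = n /\ size (sigma n k u) = n by rewrite !size_sigma.
have sjj v : size v = n -> sigma n j (sigma n j v) = sigma n j v.
  move=> sv; apply: (@eq_from_nth _ 0%N); first by rewrite !size_sigma // size_sigma.
  move=> p _; rewrite !nth_sigma -!ij; repeat case: eqP => //=; lia.
have skk v : size v = n -> sigma n k (sigma n k v) = sigma n k v.
  move=> sv; apply: (@eq_from_nth _ 0%N); first by rewrite !size_sigma // size_sigma.
  move=> p _; rewrite !nth_sigma -!jk; repeat case: eqP => //=; lia.
rewrite sjj // skk; last by rewrite size_sigma.
have -> : sigma n k (sigma n j (sigma n k u)) = sigma n j (sigma n k (sigma n j u)).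
  apply: (@eq_from_nth _ 0%N); first by rewrite !size_sigma // !size_sigma // size_sigma.
  move=> p _; rewrite !nth_sigma -!ij -!jk; repeat case: eqP => //=; lia.
rewrite !nth_sigma -!ij -!jk !eqxx.
move: nij njk nik nji nkj nki => /eqP/negbTE nij /eqP/negbTE njk /eqP/negbTE nik.
move=> /eqP/negbTE nji /eqP/negbTE nkj /eqP/negbTE nki.
rewrite ?nij ?njk ?nik ?nji ?nkj ?nki ?eqxx.
set F := f (sigma n j (sigma n k _)); set G := f (sigma n k _).
set a := nth _ u i; set b := nth _ u j; set c := nth _ u k.
(* If [c <= maxn a b], the weights agree separately at [F] and at [G]; otherwise they are exchanged,
   and [F = G]. *)
case: (leqP c (maxn a b)) => h.
  case: (leqP b c) => h'; ring.
have -> : F = G.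
  congr f; apply: (@eq_from_nth _ 0%N); first by rewrite !size_sigma // size_sigma.
  move=> p _; rewrite !nth_sigma -!ij -!jk ?nij ?njk ?nik ?nji ?nkj ?nki ?eqxx.
  rewrite -/a -/b -/c; repeat case: eqP => //=; lia.
by case: (leqP b c) => h'; ring.
Qed.

End Operators.

(** * Arcs of the circle of positions *)

Section Arcs.
Local Open Scope nat_scope.
Variable n : nat.

(** The start [a] is not reduced mod [n], so an arc crossing position 0 needs no case distinction.
    [P] stands for membership in S. *)
Definition seg (P : pred nat) (a len : nat) : seq nat :=
  [seq i <- [seq t %% n | t <- iota a len] | P i].

Lemma segD P a l1 l2 : seg P a (l1 + l2) = seg P a l1 ++ seg P (a + l1) l2.
Proof. by rewrite /seg iotaD map_cat filter_cat. Qed.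

Lemma seg1 P a : seg P a 1 = if P (a %% n) then [:: a %% n] else [::].
Proof. by []. Qed.

Lemma segSr P a len : seg P a len.+1 =
  if P ((a + len) %% n) then rcons (seg P a len) ((a + len) %% n) else seg P a len.
Proof. by rewrite -addn1 segD seg1; case: ifP; rewrite ?cats1 ?cats0. Qed.

Lemma segP (P : pred nat) a len i :
  reflect (exists2 t, a <= t < a + len & i = t %% n /\ P i) (i \in seg P a len).
Proof.
rewrite mem_filter; apply: (iffP andP) => [[Pi /mapP[t]]|[t tP [-> Pt]]].
  by rewrite mem_iota => tP e; exists t.
by split=> //; apply: map_f; rewrite mem_iota.
Qed.

Lemma eq_seg P Q a len : (forall t, a <= t < a + len -> P (t %% n) = Q (t %% n)) ->
  seg P a len = seg Q a len.
Proof.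
move=> PQ; apply: eq_in_filter => i /mapP[t]; rewrite mem_iota => tP ->.
exact: PQ.
Qed.

Lemma seg_lt P a len : 0 < n -> {in seg P a len, forall i, i < n}.
Proof. by move=> n0 i /segP[t _ [-> _]]; rewrite ltn_mod. Qed.

Lemma modn_window s t : s < t < s + n -> s %% n != t %% n.
Proof.
move=> st; have -> : t = s + (t - s) by lia.
by rewrite -{1}[s]addn0 eqn_modDl mod0n modn_small; lia.
Qed.

Lemma seg_uniq P a len : len <= n -> uniq (seg P a len).
Proof.
move=> ln; apply: filter_uniq; rewrite map_inj_in_uniq ?iota_uniq //.
move=> s t; rewrite !mem_iota => sP tP e; apply/eqP.
by case: ltngtP => // st; [have := @modn_window s t|have := @modn_window t s];
  rewrite e eqxx; lia.
Qed.

(** The bounds exclude adjacency on both sides: [t = s + 1], and [t = s + n - 1] around the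
    circle. *)
Lemma far_modn s t : 0 < n -> s.+1 < t < s + n.-1 -> far n (s %% n) (t %% n).
Proof.
move=> n0 st; have t1 : t = t.-1.+1 by lia.
apply/and3P; split; first by apply: modn_window; lia.
  apply/eqP => /esym; rewrite -prv_modS // => /prv_inj.
  rewrite !ltn_mod n0 => /(_ isT isT) /esym/eqP.
  by apply/negP/modn_window; lia.
by rewrite t1 prv_modS //; apply: modn_window; lia.
Qed.

(** Supplies the three distinct positions of [act_braid]; for [n = 2] the outer two coincide. *)
Lemma prv_distinct j : 2 < n -> j < n ->
  [/\ prv n (prv n j) != prv n j, prv n j != j & prv n (prv n j) != j].
Proof.
move=> n2 jn; have := prv_lt jn; rewrite (prvE jn) => pn.
rewrite (prvE pn); move: pn; case: (j =P 0) => j0 /= pn.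
  by split; apply/eqP; rewrite ?ifF; lia.
by case: (j.-1 =P 0) => p0; split; apply/eqP; lia.
Qed.

End Arcs.

(** * Commutation within one segment *)

Section SetProduct.
Variables (R : comNzRingType) (n : nat) (x : nat -> R).
Hypothesis n_gt0 : (0 < n)%N.
Notation act := (sigma_op n x).
Notation ops := (sigma_ops n x).

Lemma ops_rcons l j f : ops (rcons l j) f = ops l (act j f).
Proof. by rewrite -cats1 ops_cat. Qed.

Lemma ops_add l f g u : ops l (fun v => f v + g v) u = ops l f u + ops l g u.
Proof. by elim: l u => //= j l IH u; rewrite /sigma_op IH mulrDr. Qed.

(* Induction on the last index j: it commutes with everything before it except
   possibly j - 1, where act_braid applies. *)
Lemma seg_sum_comm P a len f u : size u = n -> (len < n)%N ->
  \sum_(i <- seg n P a len) ops (rcons (seg n P a len) i) f u =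
  \sum_(i <- seg n P a len) ops (i :: seg n P a len) f u.
Proof.
move=> su; elim: len f => [|len IH] f lenn; first by rewrite !big_nil.
rewrite segSr; case: ifP => Pj; last by apply: IH; lia.
set j := ((a + len) %% n)%N in Pj *.
have jn : (j < n)%N by rewrite ltn_mod.
case: len => [|len] in IH lenn j jn Pj *; first by rewrite !big_seq1.
set l := seg n P a len.
have ln : {in l, forall p, (p < n)%N} by apply: seg_lt.
have lj : {in l, forall p, far n p j}.
  by move=> p /segP[t tP [-> _]]; apply: far_modn => //; lia.
have jl g v : size v = n -> ops (rcons l j) g v = ops (j :: l) g v.
  by move=> sv; apply: ops_comm.
have swap p g v : size v = n -> p \in l -> act j (act p g) v = act p (act j g) v.
  by move=> sv pl; apply: act_comm => //; [exact: ln | rewrite far_sym lj].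
have := IH (act j f) (ltnW lenn); rewrite segSr; case: ifP => Pi; rewrite -/l.
  set i := ((a + len) %% n)%N in Pi *.
  have iN : (i < n)%N by rewrite ltn_mod.
  have li : {in rcons l i, forall p, (p < n)%N}.
    by move=> p; rewrite mem_rcons inE => /predU1P[->|/ln].
  rewrite !big_rcons /= => IHj.
  (* Each [p] in [l] moves past [j]. The terms of [i] and [j] form, after the prefix [l], the
     left-hand side of [act_braid]; the segment has [len.+2 < n] positions, hence [2 < n]. *)
  transitivity (\sum_(p <- l) ops (rcons (rcons l i) p) (act j f) u +
    ops l (act i (act i (act j f))) u + ops l (act j (act i (act j f))) u).
    rewrite -!addrA; congr (_ + _).
      rewrite !big_seq; apply: eq_bigr => p pl.
      rewrite !ops_rcons; apply: eq_ops => // v sv.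
      by congr (_ * _); apply: swap => //; rewrite size_sigma.
    rewrite !ops_rcons -!ops_add; apply: eq_ops => // v sv.
    have ij : i = prv n j by rewrite /i /j addnS prv_modS.
    have [|d1 d2 d3] := prv_distinct _ jn; first by lia.
    by apply: (@act_braid _ n x (prv n i) i j) => //; rewrite ij.
  rewrite !ops_rcons in IHj; rewrite IHj !ops_rcons; congr (_ + _).
  by rewrite -ops_rcons jl.
(* The predecessor of [j] is absent here, so [j] commutes with all of [l]. *)
move=> IHj; rewrite !big_rcons /=; congr (_ + _); last first.
  by rewrite ops_rcons jl // ops_rcons.
transitivity (\sum_(p <- l) ops (rcons l p) (act j f) u); last first.
  rewrite IHj; apply: eq_bigr => p _; by rewrite -ops_rcons.
rewrite !big_seq; apply: eq_bigr => p pl.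
by rewrite !ops_rcons; apply: eq_ops => // v sv; apply: swap.
Qed.

End SetProduct.

(** * The product over a proper subset, and its link with [sigmaS] *)

Section FullArcs.
Variables (R : comNzRingType) (n : nat) (x : nat -> R).
Hypothesis n_gt0 : (0 < n)%N.
Notation act := (sigma_op n x).
Notation ops := (sigma_ops n x).
Notation arc P m := (seg n P m.+1 n.-1).

Lemma seg_mod P a b len : a = b %[mod n] -> seg n P a len = seg n P b len.
Proof.
move=> ab; rewrite /seg -[a]addn0 -[b]addn0 !iotaDl -!map_comp.
by congr filter; apply: eq_map => t /=; rewrite -modnDml ab modnDml.
Qed.

(* The two pieces of the circle cut out by m and p contain no adjacent positions. *)
Lemma ops_arc_base P m p f u : size u = n -> (m < n)%N -> (p < n)%N ->
  ~~ P m -> ~~ P p -> ops (arc P m) f u = ops (arc P p) f u.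
Proof.
move=> su; wlog mp : m p / (m < p)%N => [hw mn pn Pm Pp|mn pn Pm Pp].
  by case: (ltngtP m p) => [h|h|->] //; [|symmetry]; apply: hw.
have -> : arc P m = seg n P m.+1 (p - m).-1 ++ seg n P p.+1 (n - (p - m)).-1.
  have -> : n.-1 = ((p - m).-1 + (1 + (n - (p - m)).-1))%N by lia.
  rewrite !segD seg1.
  have -> : (m.+1 + (p - m).-1)%N = p by lia.
  by rewrite modn_small // (negbTE Pp) addn1.
have -> : arc P p = seg n P p.+1 (n - (p - m)).-1 ++ seg n P m.+1 (p - m).-1.
  have -> : n.-1 = ((n - (p - m)).-1 + (1 + (p - m).-1))%N by lia.
  rewrite !segD seg1.
  have -> : (p.+1 + (n - (p - m)).-1)%N = (n + m)%N by lia.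
  rewrite modnDl modn_small // (negbTE Pm); congr (_ ++ _).
  by apply: seg_mod; rewrite -addnA addn1 modnDl.
apply: ops_cat_comm => //; try exact: seg_lt.
move=> i j /segP[s sP [-> _]] /segP[t tP [-> _]].
by apply: far_modn => //; lia.
Qed.

Lemma nth_foldl_sigma l j u : {in l, forall p, j != p /\ j != prv n p} ->
  nth 0%N (foldl (fun v p => sigma n p v) u l) j = nth 0%N u j.
Proof.
elim: l u => //= p l IH u jl.
rewrite IH => [|q ql]; last by apply: jl; rewrite inE ql orbT.
have [|j1 j2] := jl p; first by rewrite inE eqxx.
by rewrite nth_sigma (negbTE j1) (negbTE j2).
Qed.

(** The letter at a position is changed only by its own index and by the next one. As [len < n],
    neither occurs earlier in the segment, so every weight can be read off the initial word. *)
Lemma ops_seg P a len f u : (len < n)%N ->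
  ops (seg n P a len) f u = \prod_(i <- seg n P a len) x (nth 0%N u i) *
    f (foldl (fun v p => sigma n p v) u (seg n P a len)).
Proof.
elim: len f => [|len IH] f lenn; first by rewrite big_nil mul1r.
rewrite segSr; case: ifP => Pj; last by apply: IH; lia.
set j := (_ %% n)%N.
rewrite ops_rcons IH; last by lia.
rewrite big_rcons /= foldl_rcons -mulrA; congr (_ * _).
rewrite /sigma_op nth_foldl_sigma // => p /segP[t tP [-> _]]; split.
  by rewrite eq_sym; apply: modn_window; lia.
apply/eqP; rewrite /j -(@prv_modS _ (a + len)) // => /prv_inj; rewrite !ltn_mod n_gt0.
move=> /(_ isT isT) /esym/eqP; apply/negP/modn_window; lia.
Qed.

Lemma inSE (S : {set 'I_n}) (i : 'I_n) : inS S i = (i \in S).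
Proof.
apply/existsP/idP => [[j /andP[jS /eqP/val_inj <-]]//|iS].
by exists i; rewrite iS eqxx.
Qed.

(** The cut used by [sigmaS]; it equals [n] when [S] is everything, a case excluded in [gapP]. *)
Definition gap (S : {set 'I_n}) : nat := find (fun t => ~~ inS S t) (iota 0 n).

Lemma gapP (S : {set 'I_n}) : (#|S| < n)%N -> (gap S < n)%N /\ ~~ inS S (gap S).
Proof.
move=> Sn; have hasS : has (fun t => ~~ inS S t) (iota 0 n).
  have /set0Pn[i] : ~: S != set0 by rewrite -card_gt0 cardsCs setCK card_ord; lia.
  rewrite inE -inSE => iS; apply/hasP; exists (val i) => //.
  by rewrite mem_iota /=.
have gn : (gap S < n)%N by rewrite -[X in (_ < X)%N](size_iota 0 n) -has_find.
by split=> //; have := nth_find 0%N hasS; rewrite nth_iota.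
Qed.

Definition set_op (S : {set 'I_n}) f u := ops (arc (inS S) (gap S)) f u.
Notation cyc := set_op.

(** The free choice of the cut outside [S] is what later brings a given index to either end of the
    product. *)
Lemma cyc_base (S : {set 'I_n}) m f u : size u = n ->
  ~~ inS S (m %% n) -> (#|S| < n)%N -> cyc S f u = ops (arc (inS S) m) f u.
Proof.
move=> su mS /gapP[gn gS].
rewrite (@seg_mod _ m.+1 (m %% n).+1); last by rewrite -[in RHS]addn1 modnDml addn1.
by apply: ops_arc_base => //; rewrite ltn_mod.
Qed.

Lemma arc_perm (S : {set 'I_n}) m : ~~ inS S (m %% n) ->
  perm_eq (arc (inS S) m) [seq val i | i <- enum S].
Proof.
move=> mS; apply: uniq_perm.
- by apply: seg_uniq; lia.
- by rewrite map_inj_uniq ?enum_uniq //; apply: val_inj.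
move=> i; apply/segP/mapP => [[t tP [it iS]]|[j]].
  have iN : (i < n)%N by rewrite it ltn_mod.
  by exists (Ordinal iN) => //; rewrite mem_enum -inSE.
rewrite mem_enum -inSE => jS ->.
pose r := (m %% n)%N; have rn : (r < n)%N by rewrite ltn_mod.
have jn := ltn_ord j.
have jr : val j <> r by move=> jr; move: mS; rewrite -/r -jr jS.
(* [m - r] is a multiple of [n]; adding [j], or [j + n] if [j < r], gives the representative of [j]
   between [m + 1] and [m + n - 1]. *)
exists (m - r + (if (j < r)%N then j + n else j))%N; last split => //.
  have rm := leq_mod m n; rewrite -/r in rm; move: (r) rn rm jr => q rn rm jr.
  by rewrite /= in jr *; case: (ltnP j q); lia.
rewrite [in RHS](divn_eq m n) -/r addnK.
by rewrite modnMDl; case: ifP => _; rewrite ?modnDr modn_small.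
Qed.

Lemma big_arc (T : Type) (idx : T) (op : Monoid.com_law idx) (S : {set 'I_n}) m F :
  ~~ inS S (m %% n) ->
  \big[op/idx]_(i <- arc (inS S) m) F i = \big[op/idx]_(i in S) F (val i).
Proof.
move=> mS; rewrite (perm_big _ (arc_perm mS)) big_map big_enum_cond /=.
by apply: eq_bigl => i; rewrite andbT.
Qed.

Lemma cycE (S : {set 'I_n}) f u : (#|S| < n)%N ->
  cyc S f u = (\prod_(i in S) x (nth 0%N u i)) * f (sigmaS S u).
Proof.
move=> /gapP[gn gS]; rewrite /cyc ops_seg; last by lia.
rewrite big_arc ?modn_small //; congr (_ * f (foldl _ _ _)).
rewrite /sigmaS -/(gap S) /seg -[(gap S).+1]addn1 iotaDl -map_comp filter_map.
by [].
Qed.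

End FullArcs.

(** * Commutation of M_1 with M_k *)

Section Commutation.
Variables (R : comNzRingType) (n : nat) (x : nat -> R).
Hypothesis n_gt1 : (1 < n)%N.
Notation act := (sigma_op n x).
Notation ops := (sigma_ops n x).
Notation cyc := (@set_op R n x).
Notation arc P m := (seg n P m.+1 n.-1).
Implicit Types (S U : {set 'I_n}) (i : 'I_n).

Let n_gt0 : (0 < n)%N := ltnW n_gt1.

Lemma ordS_neq i : ordS i != i.
Proof.
rewrite -val_eqE /= -[X in _ != X](modn_small (ltn_ord i)) eq_sym.
by apply: modn_window; lia.
Qed.

Lemma eq_inS_arc S U a len : (forall i, (exists2 t, (a <= t < a + len)%N & val i = t %% n)%N ->
  (i \in S) = (i \in U)) -> seg n (inS S) a len = seg n (inS U) a len.
Proof.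
move=> SU; apply: eq_seg => t tP.
have tn : (t %% n < n)%N by rewrite ltn_mod.
by rewrite -[(t %% n)%N]/(val (Ordinal tn)) !inSE; apply: SU; exists t.
Qed.

Lemma card_setU1_lt S i j : j != i -> j \notin S -> (#|i |: S| < n)%N.
Proof.
move=> ji jS; rewrite -[X in (_ < X)%N]card_ord -cardsT; apply: proper_card.
by rewrite properT; apply/negP => /eqP/setP/(_ j); rewrite !inE (negbTE ji) (negbTE jS).
Qed.

Lemma inS_modn S i t : (t %% n)%N = i -> inS S (t %% n) = (i \in S).
Proof. by move=> ->; rewrite inSE. Qed.

(** Cutting at the successor of [i], which is outside both sets, makes [i] the last index. *)
Lemma cyc_act_last S i f u : size u = n -> (#|S| < n)%N ->
  i \notin S -> ordS i \notin S -> cyc S (act i f) u = cyc (i |: S) f u.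
Proof.
move=> su Sn iS jS.
rewrite !(@cyc_base _ _ _ _ _ i.+1) //; last 3 first.
- by rewrite (@inS_modn _ (ordS i)) // !inE negb_or ordS_neq.
- exact: card_setU1_lt (ordS_neq i) jS.
- by rewrite (@inS_modn _ (ordS i)).
have -> : n.-1 = (n.-2).+1 by lia.
have iE : ((i.+2 + n.-2) %% n)%N = i.
  by rewrite (_ : (i.+2 + n.-2)%N = (i + n)%N) ?modnDr ?modn_small //; lia.
rewrite !segSr !(inS_modn _ iE) (negbTE iS) setU11 iE ops_rcons.
rewrite (@eq_inS_arc (i |: S) S) // => j [t tP jE]; rewrite !inE.
case: eqP => // ji; subst j.
have := @modn_window n t (i.+2 + n.-2); rewrite iE -jE eqxx; lia.
Qed.

(** Cutting at the predecessor of [i] makes [i] the first index. *)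
Lemma cyc_act_first S i f u : size u = n -> (#|S| < n)%N ->
  i \notin S -> ord_pred i \notin S -> act i (cyc S f) u = cyc (i |: S) f u.
Proof.
move=> su Sn iS jS; set p := ord_pred i.
have ip : i = ordS p by rewrite ord_predK.
have pi : p != i by rewrite eq_sym ip ordS_neq.
have pmod : (p %% n)%N = p by rewrite modn_small.
rewrite /sigma_op !(@cyc_base _ _ _ _ _ p) ?size_sigma ?pmod ?inSE //; last first.
- exact: card_setU1_lt pi jS.
- by rewrite !inE negb_or pi.
have -> : n.-1 = (1 + n.-2)%N by lia.
have iE : (p.+1 %% n)%N = i by rewrite ip.
rewrite !segD !seg1 !(inS_modn _ iE) (negbTE iS) setU11 iE.
rewrite (@eq_inS_arc (i |: S) S) // => j [t tP jE]; rewrite !inE.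
case: eqP => // ji; subst j.
have := @modn_window n p.+1 t; rewrite iE -jE eqxx; lia.
Qed.

(** Cut at [i], the product for [S] starts with [ordS i]. What follows, ended by the extra [i], is
    the arc of the swapped set cut at [ordS i]. *)
Lemma cyc_act_shift S i f u : size u = n -> (#|S| < n)%N ->
  i \notin S -> ordS i \in S ->
  cyc S (act i f) u = act (ordS i) (cyc (tperm i (ordS i) @: S) f) u.
Proof.
move=> su Sn iS jS; set U := _ @: S.
have inU j : (j \in U) = (tperm i (ordS i) j \in S).
  by rewrite -[j in LHS](tpermK i (ordS i)) mem_imset //; apply: perm_inj.
have imod : (i %% n)%N = i by rewrite modn_small.
have jE : (i.+1 %% n)%N = ordS i by [].
have Un : (#|U| < n)%N by rewrite card_imset //; apply: perm_inj.
rewrite /sigma_op (@cyc_base _ _ _ _ _ i) ?imod ?inSE //.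
rewrite (@cyc_base _ _ _ _ _ i.+1) ?size_sigma //; last first.
  by rewrite (inS_modn _ jE) inU tpermR.
rewrite [in RHS](_ : n.-1 = n.-2.+1); last by lia.
have -> : n.-1 = (1 + n.-2)%N by lia.
have iE : ((i.+2 + n.-2) %% n)%N = i.
  by rewrite (_ : (i.+2 + n.-2)%N = (i + n)%N) ?modnDr ?modn_small //; lia.
rewrite segD seg1 (inS_modn _ jE) jS segSr (inS_modn _ iE) inU tpermL jS iE ops_rcons jE.
rewrite addn1 (@eq_inS_arc U S) // => j [t tP jt].
rewrite inU tpermD //; apply/eqP => ij; subst j.
  have := @modn_window n t (i.+2 + n.-2); rewrite iE -jt eqxx; lia.
have := @modn_window n i.+1 t; rewrite jE -jt eqxx; lia.
Qed.

(** Adding the pairs of neighbours inside [U], indexed by their left or by their right member,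
    completes either sum to the sum over [U]. *)
Lemma run_ends (U : {set 'I_n}) (c : R) :
  \sum_(i in U | ordS i \notin U) c = \sum_(i in U | ord_pred i \notin U) c.
Proof.
apply: (@addrI _ (\sum_(i in U | ordS i \in U) c)); rewrite -bigID.
rewrite (bigID (fun i => ord_pred i \in U)) /=; congr (_ + _).
rewrite (reindex_inj (can_inj (@ordSK n))) /=.
by apply: eq_bigl => i; rewrite ordSK andbC.
Qed.

(** Both sides run over pairs [(S, i)]. Pairs with [i] in [S] match set by set. The others are split
    by whether a neighbour of [i] is in [S]: the predecessor on the left-hand side, the successor on
    the right-hand side. *)
Lemma sum_act_cyc k (f : seq nat -> R) (u : seq nat) : size u = n -> (k < n)%N ->
  \sum_(i < n) act i (fun v => \sum_(S : {set 'I_n} | #|S| == k) cyc S f v) u =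
  \sum_(S : {set 'I_n} | #|S| == k) cyc S (fun v => \sum_(i < n) act i f v) u.
Proof.
move=> su kn.
transitivity (\sum_(S : {set 'I_n} | #|S| == k) \sum_(i < n) act i (cyc S f) u).
  rewrite exchange_big; apply: eq_bigr => i _ /=.
  by rewrite /sigma_op big_distrr.
transitivity (\sum_(S : {set 'I_n} | #|S| == k) \sum_(i < n) cyc S (act i f) u); last first.
  by apply: eq_bigr => S _; rewrite /set_op ops_sum.
have sumI (F : {set 'I_n} -> 'I_n -> R) :
    \sum_(S : {set 'I_n} | #|S| == k) \sum_i F S i =
    \sum_(S : {set 'I_n} | #|S| == k) \sum_(i in S) F S i +
    \sum_i \sum_(S : {set 'I_n} | (#|S| == k) && (i \notin S)) F S i.
  rewrite (exchange_big_dep (fun S : {set 'I_n} => #|S| == k)) /=; last by move=> i S _ /andP[].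
  rewrite -big_split /=; apply: eq_bigr => S Sk.
  by rewrite (bigID (mem S)) /=; congr (_ + _); apply: eq_bigl => i; rewrite Sk.
rewrite !sumI; congr (_ + _).
  apply: eq_bigr => S /eqP Sk; have [gn gS] := @gapP _ n_gt0 S (eq_ind_r (fun c => c < n)%N kn Sk).
  have gm : ~~ inS S (gap S %% n) by rewrite modn_small.
  have := @seg_sum_comm _ _ x n_gt0 (inS S) (gap S).+1 n.-1 f u su.
  rewrite !(big_arc n_gt0 _ _ gm) => <-; last by lia.
  by apply: eq_bigr => i _; rewrite ops_rcons.
have split_out (F : {set 'I_n} -> 'I_n -> R) (h : 'I_n -> 'I_n) :
    \sum_i \sum_(S : {set 'I_n} | (#|S| == k) && (i \notin S)) F S i =
    \sum_i \sum_(S : {set 'I_n} | [&& #|S| == k, i \notin S & h i \in S]) F S i +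
    \sum_i \sum_(S : {set 'I_n} | [&& #|S| == k, i \notin S & h i \notin S]) F S i.
  rewrite -big_split /=; apply: eq_bigr => i _.
  rewrite (bigID (fun S : {set 'I_n} => h i \in S)) /=.
  by congr (_ + _); apply: eq_bigl => S; rewrite -andbA.
rewrite (split_out _ (@ord_pred n)) [RHS](split_out _ (@ordS n)); congr (_ + _).
  (* On the left-hand side [i] becomes [ordS i] and [S] its image under the transposition, so that
     [cyc_act_shift] matches the terms. *)
  rewrite (reindex_inj (can_inj (@ordSK n))) /=; apply: eq_bigr => i _.
  pose h (S : {set 'I_n}) := tperm i (ordS i) @: S.
  have h_inj : injective h by apply: imset_inj; apply: perm_inj.
  have hE S j : (j \in h S) = (tperm i (ordS i) j \in S).
    by rewrite -[j in LHS](tpermK i (ordS i)) mem_imset //; apply: perm_inj.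
  rewrite (reindex_inj h_inj) /=; apply: eq_big => S.
    by rewrite ordSK !hE tpermL tpermR card_imset //; apply: perm_inj.
  case/and3P => /eqP; rewrite ordSK !hE tpermL tpermR card_imset; last exact: perm_inj.
  by move=> Sk jS iS; rewrite cyc_act_shift // ?Sk //.
(* Regroup by [U = i |: S]; since [h i != i], the condition on [h i] is the same for [S] and [U]. *)
have addE (h : 'I_n -> 'I_n) : (forall i, h i != i) ->
    \sum_i \sum_(S : {set 'I_n} | [&& #|S| == k, i \notin S & h i \notin S])
      cyc (i |: S) f u =
    \sum_(U : {set 'I_n} | #|U| == k.+1) \sum_(i in U | h i \notin U) cyc U f u.
  move=> hi; rewrite [RHS](exchange_big_dep xpredT) //=; apply: eq_bigr => i _.
  rewrite (reindex_onto (fun U : {set 'I_n} => U :\ i) (fun S => i |: S)) /=; last first.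
    by move=> S /and3P[_ iS _]; rewrite setU1K.
  apply: eq_big => [U|U /andP[_ /eqP-> //]].
  rewrite !inE eqxx hi /= andbAC; case: (boolP (i \in U)) => iU.
    by rewrite setD1K // eqxx (cardsD1 i U) iU add1n eqSS andbT.
  rewrite /= !andbF; apply/negbTE/negP => /andP[/andP[_ /eqP UE] _]; by rewrite -UE setU11 in iU.
transitivity (\sum_i \sum_(S : {set 'I_n} | [&& #|S| == k, i \notin S & ord_pred i \notin S])
    cyc (i |: S) f u).
  apply: eq_bigr => i _; apply: eq_bigr => S /and3P[/eqP Sk iS jS].
  by apply: cyc_act_first; rewrite ?Sk.
rewrite addE => [|i]; last by rewrite -{2}[i]ord_predK eq_sym ordS_neq.
transitivity (\sum_i \sum_(S : {set 'I_n} | [&& #|S| == k, i \notin S & ordS i \notin S])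
    cyc (i |: S) f u); last first.
  apply: eq_bigr => i _; apply: eq_bigr => S /and3P[/eqP Sk iS jS].
  by symmetry; apply: cyc_act_last; rewrite ?Sk.
rewrite addE; last exact: ordS_neq.
by apply: eq_bigr => U _; rewrite run_ends.
Qed.

End Commutation.

(** * Perron-Frobenius arguments for nonnegative matrices with constant row sums *)

Section NonnegativeMatrices.
Variables (R : realFieldType) (N : nat).
Implicit Types (A B : 'M[R]_N) (p q y : 'rV[R]_N).

Definition balanced A (c : R) :=
  (forall i j, 0 <= A i j) /\ (forall i, \sum_j A i j = c).

Definition distr p := (forall j, 0 <= p 0 j) /\ \sum_j p 0 j = 1.

(* Transitions increasing the Lyapunov function phi lead from every state to z. *)
Definition sinks_to A (z : 'I_N) := exists phi : 'I_N -> nat,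
  forall i, i != z -> exists2 j, 0 < A i j & (phi i < phi j)%N.

Lemma balanced_mass A c y : balanced A c -> \sum_j (y *m A) 0 j = c * \sum_j y 0 j.
Proof.
move=> [_ Ac]; under eq_bigr => j _ do rewrite mxE.
rewrite exchange_big big_distrr /=; apply: eq_bigr => i _.
by rewrite -big_distrr /= Ac mulrC.
Qed.

(** The triangle inequality gives one inequality in each coordinate; both sides have the same total,
    so all are equalities. *)
Lemma eigen_normr A c y : balanced A c -> y *m A = c *: y ->
  map_mx Num.norm y *m A = c *: map_mx Num.norm y.
Proof.
move=> bA yA; have [A0 Ac] := bA; set a := map_mx _ y.
have le j : c * `|y 0 j| <= (a *m A) 0 j.
  have c0 : 0 <= c by rewrite -(Ac j) sumr_ge0.
  rewrite -{1}(ger0_norm c0) -normrM.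
  have -> : c * y 0 j = (y *m A) 0 j by rewrite yA mxE.
  rewrite !mxE; apply: le_trans (ler_norm_sum _ _ _) _.
  by apply: ler_sum => i _; rewrite normrM !mxE (ger0_norm (A0 _ _)).
have : \sum_j ((a *m A) 0 j - c * `|y 0 j|) = 0.
  rewrite sumrB (balanced_mass _ bA) -big_distrr /= [X in _ - _ * X](eq_bigr (a 0)).
    by rewrite subrr.
  by move=> j _; rewrite mxE.
move=> s0; apply/rowP => j; rewrite [RHS]mxE [in RHS]mxE.
apply/eqP; rewrite -subr_eq0; apply/eqP; apply: (psumr_eq0P _ s0) => // k _.
by rewrite subr_ge0.
Qed.

(** A state maximising [phi] among those charged by [q] must be [z]: otherwise a transition leads to
    a charged state with larger [phi]. *)
Lemma eigen_pos_sink A c z q : balanced A c -> sinks_to A z ->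
  (forall j, 0 <= q 0 j) -> q *m A = c *: q -> q != 0 -> 0 < q 0 z.
Proof.
move=> [A0 Ac] [phi phiP] q0 qA /rV0Pn[i0 qi0].
have pi0 : 0 < q 0 i0 by rewrite lt0r qi0 q0.
case: (@arg_maxnP _ i0 (fun i => 0 < q 0 i) phi pi0) => i qi max_i.
case: (eqVneq i z) => [<- //|/phiP[j Aij ij]].
suff /max_i : 0 < q 0 j by lia.
have c0 : 0 <= c by rewrite -(Ac i) sumr_ge0.
have : 0 < c * q 0 j.
  have -> : c * q 0 j = (q *m A) 0 j by rewrite qA mxE.
  rewrite mxE (bigD1 i) //= ltr_pwDl ?mulr_gt0 // sumr_ge0 // => k _.
  by rewrite mulr_ge0.
by rewrite [0 < q 0 j]lt0r q0 andbT; apply: contraTneq => ->; rewrite mulr0 ltxx.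
Qed.

(** With [d = p - q], the vectors [|d| + d] and [|d| - d] are nonnegative eigenvectors. They cannot
    both be positive at [z], so one vanishes; as [d] has sum 0, so does [|d|], and [d = 0]. *)
Lemma eigen_distr_uniq A c z p q : balanced A c -> sinks_to A z ->
  distr p -> distr q -> p *m A = c *: p -> q *m A = c *: q -> p = q.
Proof.
move=> bA sA [p0 p1] [q0 q1] pA qA.
pose d := p - q; pose a := map_mx Num.norm d.
have dA : d *m A = c *: d by rewrite mulmxBl pA qA scalerBr.
have aA : a *m A = c *: a := eigen_normr bA dA.
have d1 : \sum_j d 0 j = 0.
  rewrite (eq_bigr (fun j => p 0 j - q 0 j)) => [|j _]; last by rewrite !mxE.
  by rewrite sumrB p1 q1 subrr.
suff a0 : a = 0.
  apply/eqP; rewrite -subr_eq0; apply/eqP/rowP => j.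
  by have /rowP/(_ j) := a0; rewrite !mxE => /eqP; rewrite normr_eq0 => /eqP.
have a1 : \sum_j a 0 j = 0 -> a = 0.
  move=> s0; apply/rowP => j; rewrite [RHS]mxE.
  by apply: (psumr_eq0P _ s0) => // k _; rewrite mxE.
have sgn (e : R) : e = 1 \/ e = -1 -> a + e *: d = 0 -> a = 0.
  move=> he /eqP; rewrite addr_eq0 => /eqP ade; apply: a1.
  rewrite ade (eq_bigr (fun j => - e * d 0 j)) => [|j _]; last by rewrite !mxE mulNr.
  by rewrite -big_distrr /= d1 mulr0.
have pos (e : R) : e = 1 \/ e = -1 -> a + e *: d != 0 -> 0 < (a + e *: d) 0 z.
  move=> he; apply: (eigen_pos_sink bA sA).
    move=> j; rewrite !mxE; set t := p 0 j - q 0 j.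
    by have := ler_norm t; have := ler_norm (- t); rewrite normrN; case: he => ->; lra.
  by rewrite mulmxDl -scalemxAl aA dA !scalerDr !scalerA [e * c]mulrC.
have [/(sgn 1 (or_introl erefl))//|/(pos 1 (or_introl erefl))] := eqVneq (a + 1 *: d) 0.
have [/(sgn (-1) (or_intror erefl))//|/(pos (-1) (or_intror erefl))] := eqVneq (a + (-1) *: d) 0.
rewrite !mxE; set t := p 0 z - q 0 z.
by case: (ger0P t) => _; rewrite mulN1r mul1r ?subrr ?addNr ltxx.
Qed.

(** The constant vector is a right eigenvector, so [A - c] is singular and has a left null vector;
    its absolute value is normalised. The state [z] witnesses that [N] is positive. *)
Lemma eigen_distr_exists A c (z : 'I_N) : balanced A c ->
  exists2 p, distr p & p *m A = c *: p.
Proof.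
move=> bA; have [A0 Ac] := bA.
have /eqP/det0P[y y0 yB] : \det (A - c%:M) = 0.
  rewrite -det_tr; apply/eqP/det0P; exists (const_mx 1).
    by apply/rV0Pn; exists z; rewrite mxE oner_eq0.
  apply/rowP => i; rewrite !mxE (eq_bigr (fun j => A i j - c *+ (i == j))) => [|j _].
    rewrite sumrB Ac (bigD1 i) //= eqxx big1 ?addr0 ?subrr // => j /negbTE.
    by rewrite eq_sym => ->.
  by rewrite !mxE mul1r.
have yA : y *m A = c *: y.
  by apply/eqP; rewrite -subr_eq0 -mul_mx_scalar -mulmxBr yB.
pose a := map_mx Num.norm y; have a0 j : 0 <= a 0 j by rewrite mxE.
pose s := \sum_j a 0 j.
have s0 : s != 0.
  apply: contraNneq y0 => s0; apply/eqP/rowP => j; rewrite [RHS]mxE; apply/eqP.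
  have aj : a 0 j = 0 by apply: (psumr_eq0P _ s0).
  by rewrite -normr_eq0 -aj mxE.
have sge : 0 <= s by apply: sumr_ge0.
exists (s^-1 *: a); last by rewrite -scalemxAl (eigen_normr bA yA) !scalerA mulrC.
split=> [j|]; first by rewrite mxE mulr_ge0 ?invr_ge0.
rewrite (eq_bigr (fun j => s^-1 * a 0 j)) => [|j _]; last by rewrite mxE.
by rewrite -big_distrr /= mulVf.
Qed.

(** By commutation [p *m B], divided by [b], is again a distribution and eigenvector of [A], hence
    equal to [p]. *)
Lemma eigen_distr_comm A B a b z p : balanced A a -> balanced B b -> 0 < b ->
  sinks_to A z -> A *m B = B *m A -> distr p -> p *m A = a *: p -> p *m B = b *: p.
Proof.
move=> bA bB b0 sA AB dp pA; have [B0 Bc] := bB; have [p0 p1] := dp.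
have bn0 : b != 0 by rewrite gt_eqF.
suff {2}-> : p = b^-1 *: (p *m B) by rewrite scalerA mulfV ?scale1r.
apply: (eigen_distr_uniq bA sA dp) => //; last first.
  by rewrite -scalemxAl -mulmxA -AB mulmxA pA -scalemxAl !scalerA mulrC.
split=> [j|].
  rewrite !mxE; apply: mulr_ge0; first by rewrite invr_ge0 ltW.
  by apply: sumr_ge0 => i _; apply: mulr_ge0.
rewrite (eq_bigr (fun j => b^-1 * (p *m B) 0 j)) => [|j _]; last by rewrite mxE.
by rewrite -big_distrr /= (balanced_mass _ bB) p1 mulr1 mulVf.
Qed.

End NonnegativeMatrices.

(** * A potential that increases towards the sorted word *)

Section Potential.
Local Open Scope nat_scope.
Variable n : nat.

Definition moment (u : seq nat) : nat := \sum_(i < n) i * nth 0 u i.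

(** A swap moves the larger letter right. The condition [0 < j] excludes the pair across the
    boundary, where a swap lowers the moment. *)
Lemma moment_sigma j u : 0 < j < n ->
  if nth 0 u j < nth 0 u j.-1 then moment u < moment (sigma n j u)
  else moment (sigma n j u) == moment u.
Proof.
move=> /andP[j0 jn]; case: ltnP => h; last first.
  rewrite /sigma -/(prv n j) prvE //; case: (j =P 0) => [|_]; first by lia.
  by rewrite h eqxx.
have pn : j.-1 < n by lia.
have pj : Ordinal pn != Ordinal jn by rewrite -val_eqE /=; lia.
have pE : prv n j = j.-1 by rewrite prvE //; case: eqP => //; lia.
rewrite /moment (bigD1 (Ordinal jn)) //= (bigD1 (Ordinal pn)) //=.
rewrite [X in _ < X](bigD1 (Ordinal jn)) //= [X in _ < _ + X](bigD1 (Ordinal pn)) //=.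
rewrite !nth_sigma eqxx pE eqxx (_ : (j.-1 == j) = false); last by lia.
rewrite [X in _ < _ + (_ + X)](eq_bigr (fun i : 'I_n => i * nth 0 u i)); last first.
  move=> i /andP[]; rewrite -!val_eqE /= => ij ip.
  by rewrite nth_sigma pE (negbTE ij) (negbTE ip).
move: (\sum_(_ < n | _) _) => X.
by case: j j0 {jn pn pj pE} h => // j _ /= h; rewrite !mulSn; nia.
Qed.

Lemma moment_foldl_sigma l u : {in l, forall j, 0 < j < n} ->
  moment u <= moment (foldl (fun v j => sigma n j v) u l).
Proof.
elim: l u => //= j l IH u lj.
apply: leq_trans (IH _ _) => [|i il]; last by apply: lj; rewrite inE il orbT.
have := @moment_sigma j u (lj j (mem_head _ _)).
by case: ifP => _; [exact: ltnW | move/eqP->].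
Qed.

(** The first index before [j] that changes the word already raises the moment; if there is none,
    [j] meets [u] itself with its descent. *)
Lemma moment_foldl_sigma_lt l u j : {in l, forall j, 0 < j < n} ->
  j \in l -> nth 0 u j < nth 0 u j.-1 ->
  moment u < moment (foldl (fun v j => sigma n j v) u l).
Proof.
elim: l u => //= i l IH u li jil ju.
have li' : {in l, forall j, 0 < j < n}.
  by move=> k kl; apply: li; rewrite inE kl orbT.
have i0 : 0 < i < n := li i (mem_head _ _).
have := @moment_sigma i u i0; case: ifP => iu si.
  exact: leq_trans si (moment_foldl_sigma _ li').
have ui : sigma n i u = u.
  rewrite /sigma -/(prv n i) prvE; last by lia.
  by case: (i =P 0) => [|_]; [lia | rewrite leqNgt iu].
rewrite ui; apply: IH => //; move: jil; rewrite inE => /predU1P[ji|//].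
by rewrite -ji ju in iu.
Qed.

Lemma exists_subset_ord (j k : nat) (jn : j < n) : 0 < j -> 0 < k < n ->
  exists S : {set 'I_n}, [/\ #|S| = k, Ordinal jn \in S & forall i : 'I_n, i \in S -> 0 < i].
Proof.
move=> j0 kn; have n0 : 0 < n by lia.
pose o := Ordinal n0; pose J := Ordinal jn.
have oJ : o != J by rewrite -val_eqE /=; lia.
pose B := ~: [set o; J].
have cB : #|B| = n.-2 by have := cardsC [set o; J]; rewrite cards2 oJ card_ord -/B; lia.
(* The other [k - 1] elements come from the [n - 2] positions besides 0 and [j], which suffice
   because [k < n]. *)
have : 0 < #|[set A : {set 'I_n} | A \subset B & #|A| == k.-1]|.
  by rewrite cards_draws cB bin_gt0; lia.
move=> /card_gt0P[A]; rewrite inE => /andP[/subsetP AB /eqP Ak].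
have JA : J \notin A by apply/negP => /AB; rewrite !inE eqxx orbT.
exists (J |: A); split; first by rewrite cardsU1 JA Ak; lia.
  exact: setU11.
move=> i; rewrite !inE => /predU1P[-> //|/AB]; rewrite !inE negb_or -!val_eqE /=.
by case/andP => i0 _; lia.
Qed.

Lemma sigmaS_ascends u k : 0 < k < n -> size u = n -> ~~ sorted leq u ->
  exists2 S : {set 'I_n}, #|S| = k & moment u < moment (sigmaS S u).
Proof.
move=> kn su nsort.
have [j /andP[j0 jn] ju] : exists2 j, 0 < j < n & nth 0 u j < nth 0 u j.-1.
  have /hasP[j] : has (fun j => nth 0 u j < nth 0 u j.-1) (iota 1 n.-1).
    apply: contraR nsort => /hasPn h; apply/(sortedP 0) => i; rewrite su => iN.
    by rewrite leqNgt (h i.+1) // mem_iota; lia.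
  by rewrite mem_iota => jP ju; exists j => //; lia.
have [S [Sk jS S0]] := exists_subset_ord jn j0 kn.
exists S => //; have n0 : 0 < n by lia.
(* Since 0 is not in [S], [sigmaS] cuts there and uses only positive indices, in increasing
   order. *)
have gap0 : find (fun t => ~~ inS S t) (iota 0 n) = 0.
  case: n n0 S S0 {jS Sk jn} => // m _ S S0 /=.
  by rewrite (inSE S ord0); case: ifPn => //; rewrite negbK => /S0.
rewrite /sigmaS gap0; apply: (moment_foldl_sigma_lt (j := j)) => //.
  move=> i /mapP[t]; rewrite mem_filter mem_iota add0n => /andP[tS tP] ->.
  by rewrite modn_small; lia.
apply/mapP; exists j; last by rewrite modn_small.
by rewrite mem_filter mem_iota add0n modn_small // (inSE S (Ordinal jn)) jS; lia.
Qed.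

Lemma perm_sigmaS (S : {set 'I_n}) u : 0 < n -> size u = n -> perm_eq (sigmaS S u) u.
Proof.
move=> n0 su; rewrite /sigmaS; move: (find _ _) => m.
have : {in [seq (m + t) %% n | t <- iota 1 n.-1 & inS S ((m + t) %% n)], forall j, j < n}.
  by move=> j /mapP[t _ ->]; rewrite ltn_mod.
elim: map u su => [//|j l IH] u su lj /=.
have jn : j < n by apply: lj; rewrite mem_head.
apply: perm_trans (IH _ _ _) (perm_sigma su jn); first by rewrite size_sigma.
by move=> i il; apply: lj; rewrite inE il orbT.
Qed.

End Potential.

(** * Transfer operators and total rates *)

Section Transfer.
Variables (R : realType) (n : nat) (x : nat -> R).
Hypothesis n_gt1 : (1 < n)%N.
Let n_gt0 : (0 < n)%N := ltnW n_gt1.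

Definition transfer k (f : seq nat -> R) (u : seq nat) : R :=
  \sum_(S : {set 'I_n} | #|S| == k) trate x S u * f (sigmaS S u).

Lemma transferE k f u : (k < n)%N ->
  transfer k f u = \sum_(S : {set 'I_n} | #|S| == k) set_op x S f u.
Proof. by move=> kn; apply: eq_bigr => S /eqP Sk; rewrite cycE ?Sk. Qed.

Lemma cyc_set1 (i : 'I_n) f u : size u = n -> set_op x [set i] f u = sigma_op n x i f u.
Proof.
move=> su; rewrite -[[set i]]setU0 -cyc_act_first ?cards0 ?inE //.
rewrite /sigma_op; congr (_ * _); rewrite /set_op (_ : seg _ _ _ _ = [::]) //.
rewrite /seg (@eq_filter _ _ pred0) ?filter_pred0 // => t.
by apply/negbTE/existsPn => j; rewrite inE.
Qed.

Lemma transfer1 f u : size u = n -> transfer 1 f u = \sum_(i < n) sigma_op n x i f u.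
Proof.
move=> su; rewrite transferE //.
rewrite (eq_bigl (mem [set [set i] | i in [set: 'I_n]])) => [|S]; last first.
  apply/cards1P/imsetP => [[i ->]|[i _ ->]]; first by exists i.
  by exists i.
rewrite big_imset => [|i j _ _ /set1_inj //]; apply: eq_big => [i|i _]; first by rewrite inE.
exact: cyc_set1.
Qed.

Lemma transfer_comm k f u : (k < n)%N -> size u = n ->
  transfer 1 (transfer k f) u = transfer k (transfer 1 f) u.
Proof.
move=> kn su; rewrite transfer1 // transferE //.
transitivity (\sum_(i < n) sigma_op n x i
    (fun v => \sum_(S : {set 'I_n} | #|S| == k) set_op x S f v) u).
  by apply: eq_bigr => i _; rewrite /sigma_op transferE.
rewrite sum_act_cyc //; apply: eq_bigr => S _.
apply: eq_ops => //; first exact: seg_lt.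
by move=> v sv; rewrite transfer1.
Qed.

Lemma rateKE k u v : rateK n x k u v = transfer k (fun t => (t == v)%:R) u.
Proof.
rewrite /rateK /transfer big_mkcondr; apply: eq_bigr => S _ /=.
by case: eqP => _; rewrite ?mulr1 ?mulr0.
Qed.

Lemma sum_rateK k w f u : size w = n -> u \in states w ->
  \sum_(v <- states w) rateK n x k u v * f v = transfer k f u.
Proof.
move=> sw; rewrite mem_permutations => uw; have su : size u = n by rewrite (perm_size uw).
under eq_bigr => v _ do rewrite rateKE big_distrl.
rewrite exchange_big; apply: eq_bigr => S _ /=.
have Sw : sigmaS S u \in states w.
  by rewrite mem_permutations (perm_trans (perm_sigmaS S n_gt0 su)).
rewrite (bigD1_seq _ Sw (permutations_uniq w)) /= eqxx mulr1 big1 ?addr0 // => v.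
by rewrite eq_sym => /negbTE->; rewrite mulr0 mul0r.
Qed.

Definition total_rate k u : R := \sum_(S : {set 'I_n} | #|S| == k) trate x S u.

(** An elementary symmetric function of the values [x] of the letters: a permutation of positions
    permutes the [k]-subsets. *)
Lemma total_rate_perm k u v : size v = n -> perm_eq u v ->
  total_rate k u = total_rate k v.
Proof.
move=> /eqP sv uv; pose t := Tuple sv.
have /tuple_permP[p uE] : perm_eq u t by [].
have nthE (i : 'I_n) : nth 0%N u i = nth 0%N v (p i).
  by rewrite uE -(tnth_nth 0%N) tnth_mktuple (tnth_nth 0%N).
rewrite /total_rate [RHS](reindex_inj (imset_inj (@perm_inj _ p))) /=.
apply: eq_big => [S|S _]; first by rewrite card_imset //; apply: perm_inj.
rewrite /trate big_imset /=; last by move=> i j _ _ /perm_inj.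
by apply: eq_bigr => i _; rewrite nthE.
Qed.

Hypothesis x_gt0 : forall a, (0 < a)%N -> 0 < x a.

Lemma trate_gt0 (S : {set 'I_n}) u : size u = n -> all (fun a => 0 < a)%N u ->
  0 < trate x S u.
Proof.
move=> su /allP u0; apply: prodr_gt0 => i _; apply/x_gt0/u0.
by rewrite mem_nth // su.
Qed.

(** * The chain on the rearrangements of [w] in matrix form *)

Section Chain.
Variable w : seq nat.
Hypothesis size_w : size w = n.
Hypothesis w_gt0 : all (fun a => 0 < a)%N w.

Notation N := (size (states w)).
Let st (i : 'I_N) : seq nat := nth [::] (states w) i.
Let st_in i : st i \in states w. Proof. exact: mem_nth. Qed.

Lemma states_ord u : u \in states w -> exists i, u = st i.
Proof.
move=> uw; have iN : (index u (states w) < N)%N by rewrite index_mem.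
by exists (Ordinal iN); rewrite /st nth_index.
Qed.

Lemma states_size u : u \in states w -> size u = n.
Proof. by rewrite mem_permutations => /perm_size ->. Qed.

Lemma states_gt0 u : u \in states w -> all (fun a => 0 < a)%N u.
Proof. by rewrite mem_permutations => /perm_all ->. Qed.

Lemma sum_states (F : seq nat -> R) : \sum_(u <- states w) F u = \sum_i F (st i).
Proof. by rewrite (big_nth [::]) big_mkord. Qed.

Lemma st_inj : injective st.
Proof.
move=> i j /eqP; rewrite /st nth_uniq ?permutations_uniq // => /eqP; exact: val_inj.
Qed.

(** The diagonal keeps the sets that fix the word. This gives a nonnegative matrix with constant row
    sums, from which [genQ] differs by a scalar matrix. *)
Definition rate_mx k : 'M[R]_N := \matrix_(i, j) rateK n x k (st i) (st j).

Lemma sum_rateK1 k u : u \in states w ->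
  \sum_(v <- states w) rateK n x k u v = total_rate k w.
Proof.
move=> uw; have := sum_rateK k (fun _ => 1) size_w uw.
under eq_bigr do rewrite mulr1; move=> ->.
rewrite /transfer; under eq_bigr do rewrite mulr1.
by rewrite -/(total_rate k u) (@total_rate_perm k u w) // -mem_permutations.
Qed.

Lemma rate_mx_balanced k : balanced (rate_mx k) (total_rate k w).
Proof.
split=> [i j|i].
  rewrite mxE; apply: sumr_ge0 => S _; apply/ltW/trate_gt0.
    exact: states_size.
  exact: states_gt0.
under eq_bigr do rewrite mxE.
by rewrite -(sum_states (rateK n x k (st i))) sum_rateK1.
Qed.

Lemma rate_mx_comm k : (k < n)%N -> rate_mx 1 *m rate_mx k = rate_mx k *m rate_mx 1.
Proof.
move=> kn; apply/matrixP => i j; rewrite !mxE.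
(* Entries of a product are composed operators applied to the indicator of a word. *)
have prodE a b : \sum_l rate_mx a i l * rate_mx b l j =
    transfer a (transfer b (fun v => (v == st j)%:R)) (st i).
  rewrite -(sum_rateK _ _ size_w (st_in i)) sum_states.
  by apply: eq_bigr => l _; rewrite !mxE -rateKE.
by rewrite !prodE transfer_comm // states_size.
Qed.

Lemma total_rate_gt0 k : (k <= n)%N -> 0 < total_rate k w.
Proof.
move=> kn; have tr0 (S : {set 'I_n}) : 0 < trate x S w by apply: trate_gt0.
have : (0 < #|[set S : {set 'I_n} | #|S| == k]|)%N.
  by rewrite card_draws card_ord bin_gt0.
move=> /card_gt0P[S]; rewrite inE => Sk.
by rewrite /total_rate (bigD1 S) //= ltr_pwDl // sumr_ge0 // => U _; apply: ltW.
Qed.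

(** The sink is the sorted word, with [moment] as Lyapunov function. *)
Lemma rate_mx_sinks k : (0 < k < n)%N -> exists z, sinks_to (rate_mx k) z.
Proof.
move=> kn; have [|z zE] := @states_ord (sort leq w).
  by rewrite mem_permutations perm_sort.
exists z, (fun i => moment n (st i)) => i iz.
have si := states_size (st_in i).
have nsort : ~~ sorted leq (st i).
  apply: contra iz => si'; apply/eqP/st_inj; rewrite -zE.
  apply: (sorted_eq leq_trans anti_leq) => //; first exact: (sort_sorted leq_total).
  by have := st_in i; rewrite mem_permutations [perm_eq _ (sort _ _)]perm_sym perm_sort perm_sym.
have [S Sk lt_m] := sigmaS_ascends kn si nsort.
have [|j jE] := @states_ord (sigmaS S (st i)).
  have := st_in i; rewrite !mem_permutations; apply: perm_trans.
  exact: perm_sigmaS.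
exists j; last by rewrite -jE.
rewrite mxE -jE /rateK (bigD1 S) /=; last by rewrite Sk !eqxx.
have tr0 (U : {set 'I_n}) : 0 < trate x U (st i) by apply: trate_gt0 => //; apply: states_gt0.
by rewrite ltr_pwDl // sumr_ge0 // => U _; apply: ltW.
Qed.

Definition row_of (pi : seq nat -> R) : 'rV[R]_N := \row_i pi (st i).

Lemma is_distrE pi : is_distr w pi <-> distr (row_of pi).
Proof.
rewrite /is_distr /distr sum_states.
under [in X in _ <-> X]eq_bigr do rewrite mxE.
split=> -[pi0 pi1]; split=> //.
  by move=> i; rewrite mxE pi0.
by move=> u /states_ord[i ->]; have := pi0 i; rewrite mxE.
Qed.

Lemma sum_genQ k pi v : v \in states w ->
  \sum_(u <- states w) pi u * genQ n x k w u v =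
  \sum_(u <- states w) pi u * rateK n x k u v - total_rate k w * pi v.
Proof.
move=> vw; rewrite [in RHS](bigD1_seq v) ?permutations_uniq //=.
rewrite (bigD1_seq v) ?permutations_uniq //= addrAC; congr (_ + _).
  rewrite /genQ eqxx -(sum_rateK1 k vw) (bigD1_seq v) ?permutations_uniq //=.
  by ring.
by apply: eq_bigr => u /negbTE uv; rewrite /genQ uv.
Qed.

Lemma stationaryE k pi : stationary n x k w pi <->
  row_of pi *m rate_mx k = total_rate k w *: row_of pi.
Proof.
have E j : (row_of pi *m rate_mx k) 0 j = \sum_(u <- states w) pi u * rateK n x k u (st j).
  by rewrite sum_states mxE; apply: eq_bigr => i _; rewrite !mxE.
split=> [st_pi|/rowP eig v /states_ord[j ->]].
  apply/rowP => j; rewrite E [RHS]mxE mxE; apply/eqP.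
  by rewrite -subr_eq0 -sum_genQ // st_pi.
by rewrite sum_genQ // -E eig !mxE subrr.
Qed.

End Chain.
End Transfer.

Theorem theorem3 (R : realType) (n : nat) (x : nat -> R) (w : seq nat) :
  (2 <= n)%N ->
  (forall a : nat, (0 < a)%N -> 0 < x a) ->
  size w = n ->
  all (fun a => (0 < a)%N) w ->
  exists pi : seq nat -> R,
    is_distr w pi /\
    forall k : nat, (0 < k < n)%N ->
      stationary n x k w pi /\
      (forall pi' : seq nat -> R, is_distr w pi' -> stationary n x k w pi' ->
         forall u, u \in states w -> pi' u = pi u).
Proof.
move=> n2 x0 sw w0.
have bal k := rate_mx_balanced n2 x0 sw w0 k.
have [z sz] := @rate_mx_sinks _ _ x n2 x0 w sw w0 1 n2.
have [p dp pE] := eigen_distr_exists z (bal 1%N).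
(* Outside [states w] the index is out of range and [insubd] returns the default [z]; these values
   are never tested. *)
pose pi u := p 0 (insubd z (index u (states w))).
have row_pi : row_of w pi = p.
  apply/rowP => i; rewrite mxE /pi index_uniq ?permutations_uniq //.
  by congr (p _ _); apply: val_inj; rewrite val_insubd ltn_ord.
exists pi; split=> [|k kn]; first by apply/is_distrE; rewrite row_pi.
have kn' : (k < n)%N by case/andP: kn.
have pk : p *m rate_mx n x w k = total_rate n x k w *: p.
  apply: (eigen_distr_comm (bal 1%N) (bal k) _ sz) => //.
    exact: total_rate_gt0 (ltnW kn').
  exact: rate_mx_comm.
split=> [|q /is_distrE dq /(stationaryE _ n2 sw) qE u /states_ord[i ->]].
  by apply/stationaryE; rewrite ?row_pi.
(* Uniqueness for [k] uses the sink property of its own matrix, not that of [rate_mx 1]. *)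
have [z' sz'] := rate_mx_sinks n2 x0 sw w0 kn.
have /rowP/(_ i) := eigen_distr_uniq (bal k) sz' dq dp qE pk.
by rewrite -row_pi !mxE.
Qed.
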